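(* For $\alpha\in\mathbb{N}$ the identity $$(\mu+\beta)_{\alpha}\,{}_1F_1(1;\mu+\alpha;x)\,{}_1F_1(1;\mu+\beta;x)-(\mu)_{\alpha}\,{}_1F_1(1;\mu;x)\,{}_1F_1(1;\mu+\alpha+\beta;x)$$ $$=\sum_{j=0}^{\alpha-1}\Bigl\{(\mu+1+j)_{\alpha-1-j}\,(\mu+\alpha+\beta-1-j)_{1+j}\,{}_1F_1(1;\mu+1+j;x)$$ $$-(\mu+j)_{\alpha-j}\,(\mu+\alpha+\beta-j)_{j}\,{}_1F_1(1;\mu+\alpha+\beta-j;x)\Bigr\}$$ holds for all values of the parameters $\mu,\beta,x$ for which both sides make sense.
   Context: $\mathbb{N}=\{1,2,\dots\}$. $(\mu)_n=\mu(\mu+1)\cdots(\mu+n-1)$, $(\mu)_0=1$, is the Pochhammer symbol, and ${}_1F_1(a;b;x)=\sum_{n=0}^\infty\frac{(a)_n}{(b)_n\,n!}x^n$ is the Kummer (confluent hypergeometric) function, defined when $b\neq0,-1,-2,\dots$; in particular ${}_1F_1(1;b;x)=\sum_{n=0}^\infty\frac{x^n}{(b)_n}$. *)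

(* Defs.v *)
From Stdlib Require Import Reals Factorial.
From Coquelicot Require Import Coquelicot.

Open Scope C_scope.

Fixpoint pochhammer (mu : C) (n : nat) : C :=
  match n with
  | O => 1
  | S k => pochhammer mu k * (mu + INR k)
  end.

(** [b <> 0, -1, -2, ...]: the lower parameters for which [1F1] is defined. *)
Definition kummer_lower_ok (b : C) : Prop := forall n : nat, b <> - INR n.

(** [kummer a b x] is the sum of the series [1F1(a; b; x)] in [C], selected by
    Coquelicot's [iota]. The series converges for all complex [a], [x] when
    [kummer_lower_ok b]; for other [b] the value is meaningless, since some
    denominators vanish. *)
Definition kummer (a b x : C) : C :=
  @iota C_CompleteNormedModule (fun l : C =>
    is_series
      (fun n : nat =>
         (pochhammer a n / (pochhammer b n * INR (fact n)) * x ^ n : C)) l).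

(* Main.v *)
Require Import Defs.
From Stdlib Require Import Reals.
From Coquelicot Require Import Coquelicot.
From Stdlib Require Import Factorial Lra Lia.

Open Scope C_scope.

(** Write [F b] for [1F1(1; b; x)]. Comparing power series gives
    [b F(b) = b + x F(b + 1)]. With [c = mu + alpha + beta] put
    [D j = (mu + j)_(alpha - j) (c - j)_j F(mu + j) F(c - j)].
    The left-hand side is [D alpha - D 0]. Applying the recurrence to
    [F(mu + j)] and to [F(c - j - 1)], the terms containing [x] cancel in
    [D (j + 1) - D j], which leaves exactly the [j]-th summand on the right. *)

Lemma RtoC_INR_S (n : nat) : RtoC (INR (S n)) = INR n + 1.
Proof. rewrite S_INR, RtoC_plus; reflexivity. Qed.

Lemma kummer_lower_ok_add (b : C) (k : nat) :
  kummer_lower_ok b -> kummer_lower_ok (b + INR k).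
Proof.
intros hb n E; apply (hb (n + k)%nat).
rewrite plus_INR, RtoC_plus.
replace b with (b + INR k - INR k) by ring; rewrite E; ring.
Qed.

Lemma kummer_lower_ok_neq0 (b : C) : kummer_lower_ok b -> b <> 0.
Proof. intros hb E; apply (hb 0%nat); rewrite E; simpl; ring. Qed.

(** The definition splits off the last factor; splitting off the first one is what shifts the
    parameter from [b] to [b + 1]. *)
Lemma pochhammer_succ_l (b : C) (n : nat) :
  pochhammer b (S n) = b * pochhammer (b + 1) n.
Proof.
induction n as [|n IH]; [simpl; ring|].
change (pochhammer b (S (S n))) with (pochhammer b (S n) * (b + INR (S n))).
rewrite IH, RtoC_INR_S; simpl pochhammer; ring.
Qed.

Lemma pochhammer_neq0 (b : C) (n : nat) :
  kummer_lower_ok b -> pochhammer b n <> 0.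
Proof.
intros hb; induction n as [|n IH]; simpl.
- exact C1_nz.
- apply Cmult_neq_0; [exact IH|].
  apply kummer_lower_ok_neq0, kummer_lower_ok_add, hb.
Qed.

Lemma pochhammer_1 (n : nat) : pochhammer 1 n = INR (fact n).
Proof.
induction n as [|n IH]; [reflexivity|].
simpl pochhammer; rewrite IH.
change (fact (S n)) with (S n * fact n)%nat.
rewrite mult_INR, RtoC_mult, RtoC_INR_S; ring.
Qed.

Lemma is_lim_seq_Cmod_add_INR (b : C) :
  is_lim_seq (fun n : nat => Cmod (b + INR n)) p_infty.
Proof.
(* This lower bound is the triangle inequality for [INR n = (b + INR n) + - b]. *)
apply is_lim_seq_le_p_loc with (fun n => (INR n + - Cmod b)%R).
- exists 0%nat; intros n _.
  pose proof (Cmod_triangle (b + INR n) (- b)) as T.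
  replace (b + INR n + - b) with (RtoC (INR n)) in T by ring.
  rewrite Cmod_opp, Cmod_R, Rabs_pos_eq in T by apply pos_INR; lra.
- eapply is_lim_seq_plus; [exact is_lim_seq_INR|apply is_lim_seq_const|].
  reflexivity.
Qed.

Lemma ex_series_kummer_one (b x : C) :
  kummer_lower_ok b ->
  @ex_series _ C_CompleteNormedModule
    (fun n => x ^ n / pochhammer b n : C).
Proof.
intros hb.
(* The ratio test requires nonzero terms, so [Cmod x] is replaced by
   [Cmod x + 1] to include the case [x = 0]. *)
set (r := (Cmod x + 1)%R).
assert (hr : (0 < r)%R) by (pose proof (Cmod_ge_0 x); unfold r; lra).
set (t := fun n => (r ^ n / Cmod (pochhammer b n))%R).
assert (hP : forall n, (0 < Cmod (pochhammer b n))%R)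
  by (intros n; apply Cmod_gt_0, pochhammer_neq0, hb).
assert (hpos : forall n, (0 < t n)%R)
  by (intros n; apply Rdiv_lt_0_compat; [apply pow_lt, hr|apply hP]).
apply (@ex_series_le _ C_CompleteNormedModule _ (fun n => Rabs (t n))).
- intros n; change (norm (?z : C_CompleteNormedModule)) with (Cmod z).
  rewrite Rabs_pos_eq by apply Rlt_le, hpos.
  rewrite Cmod_div by (apply pochhammer_neq0, hb).
  rewrite Cmod_pow; apply Rmult_le_compat_r.
  + apply Rlt_le, Rinv_0_lt_compat, hP.
  + apply pow_incr; pose proof (Cmod_ge_0 x); unfold r; lra.
- apply ex_series_DAlembert with 0%R; [lra| |].
  + intros n; apply Rgt_not_eq, hpos.
  (* Passing from [n] to [n + 1] multiplies [t] by [r / Cmod (b + INR n)], which tends to 0. *)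
  + apply is_lim_seq_ext with (fun n => (r * / Cmod (b + INR n))%R).
    * intros n.
      assert (hn : (0 < Cmod (b + INR n))%R)
        by (apply Cmod_gt_0, kummer_lower_ok_neq0, kummer_lower_ok_add, hb).
      rewrite Rabs_pos_eq
        by (apply Rlt_le, Rdiv_lt_0_compat; apply hpos).
      unfold t; simpl; rewrite Cmod_mult; field.
      repeat split; apply Rgt_not_eq;
        [apply hP|exact hn|apply pow_lt, hr].
    * replace (Finite 0) with (Rbar_mult r (Rbar_inv p_infty))
        by (simpl; f_equal; ring).
      apply is_lim_seq_scal_l, is_lim_seq_inv;
        [apply is_lim_seq_Cmod_add_INR|discriminate].
Qed.

(** Limits are unique, so [iota] returns any sum that is exhibited; the factor [(1)_n = n!] cancels
    the factorial in the general term. *)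
Lemma kummer_one_eq (b x l : C) :
  kummer_lower_ok b ->
  @is_series _ C_CompleteNormedModule
    (fun n => x ^ n / pochhammer b n : C) l ->
  kummer 1 b x = l.
Proof.
intros hb hl.
apply (@iota_filterlim_locally _ C_CompleteNormedModule).
- apply Proper_StrongProper, eventually_filter.
- apply (@is_series_ext _ C_CompleteNormedModule) with (2 := hl).
  intros n; cbv beta; rewrite pochhammer_1.
  match goal with |- ?u = ?v => change (u = v :> C) end; field.
  split; [|apply pochhammer_neq0, hb].
  intros E; apply (INR_fact_neq_0 n), RtoC_inj, E.
Qed.

Lemma is_series_kummer_one (b x : C) :
  kummer_lower_ok b ->
  @is_series _ C_CompleteNormedModule
    (fun n => x ^ n / pochhammer b n : C) (kummer 1 b x).
Proof.
intros hb; destruct (ex_series_kummer_one b x hb) as [l hl].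
rewrite (kummer_one_eq b x l hb hl); exact hl.
Qed.

(** Since [(b)_(n+1) = b (b+1)_n], the term of index [n + 1] in the series for [b] is [x / b] times
    the term of index [n] in the series for [b + 1]; the term of index 0 is 1. *)
Lemma kummer_one_rec (b x : C) :
  kummer_lower_ok b ->
  b * kummer 1 b x = b + x * kummer 1 (b + 1) x.
Proof.
intros hb.
assert (hb1 : kummer_lower_ok (b + 1))
  by exact (kummer_lower_ok_add b 1 hb).
pose proof (kummer_lower_ok_neq0 b hb) as b0.
rewrite (kummer_one_eq b x (1 + x / b * kummer 1 (b + 1) x) hb);
  [field; exact b0|].
apply is_series_decr_1.
pose proof (is_series_scal_l (x / b) _ _ (is_series_kummer_one _ x hb1)) as H.
match goal with |- is_series _ ?l => replace l
  with (scal (x / b) (kummer 1 (b + 1) x : C_CompleteNormedModule)) end.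
- eapply is_series_ext; [|exact H].
  intros n; cbv beta.
  rewrite pochhammer_succ_l, Cpow_S.
  change (scal (?u : C_AbsRing) (?v : C_CompleteNormedModule)) with (Cmult u v).
  (* The equation is typed in the carrier of a normed module; [field] needs it in [C]. *)
  match goal with |- ?u = ?v => change (u = v :> C) end.
  field; split; [apply pochhammer_neq0, hb1|exact b0].
- change (x / b * kummer 1 (b + 1) x =
          1 + x / b * kummer 1 (b + 1) x + - (1 / 1)).
  field; exact b0.
Qed.

Lemma sum_n_m_telescope {G : AbelianGroup} (u : nat -> G) (n : nat) :
  sum_n_m (fun j => minus (u (S j)) (u j)) 0 n = minus (u (S n)) (u 0%nat).
Proof.
induction n as [|n IH]; [rewrite sum_n_n; reflexivity|].
rewrite sum_n_Sm by lia; rewrite IH, plus_comm.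
symmetry; apply minus_trans.
Qed.

Theorem corollary4 :
  forall (alpha : nat) (mu beta x : C),
    (1 <= alpha)%nat ->
    kummer_lower_ok mu ->
    kummer_lower_ok (mu + beta) ->
    pochhammer (mu + beta) alpha
      * kummer 1 (mu + INR alpha) x * kummer 1 (mu + beta) x
    - pochhammer mu alpha
      * kummer 1 mu x * kummer 1 (mu + INR alpha + beta) x
    = sum_n_m (fun j : nat =>
          pochhammer (mu + 1 + INR j) (alpha - 1 - j)
            * pochhammer (mu + INR alpha + beta - 1 - INR j) (1 + j)
            * kummer 1 (mu + 1 + INR j) x
          - pochhammer (mu + INR j) (alpha - j)
            * pochhammer (mu + INR alpha + beta - INR j) j
            * kummer 1 (mu + INR alpha + beta - INR j) x)
        0 (alpha - 1).
Proof.
intros alpha mu beta x halpha hmu hmb.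
set (c := mu + INR alpha + beta).
set (D := fun j : nat =>
  pochhammer (mu + INR j) (alpha - j) * pochhammer (c - INR j) j
  * kummer 1 (mu + INR j) x * kummer 1 (c - INR j) x : C).
transitivity (D alpha - D 0%nat).
(* At [j = alpha] the first Pochhammer factor of [D] is empty, at [j = 0] the second. *)
{ unfold D; rewrite Nat.sub_diag, Nat.sub_0_r.
  replace (c - INR alpha) with (mu + beta) by (unfold c; ring).
  replace (mu + INR 0) with mu by (simpl; ring).
  replace (c - INR 0) with c by (simpl; ring).
  simpl pochhammer; ring. }
transitivity (sum_n_m (fun j => minus (D (S j)) (D j)) 0 (alpha - 1)).
{ rewrite (sum_n_m_telescope (G := C_AbelianGroup)).
  replace (S (alpha - 1)) with alpha by lia; reflexivity. }
apply sum_n_m_ext_loc; intros j [_ hj].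
match goal with |- _ = ?v => change (D (S j) - D j = v :> C) end.
unfold D.
set (a := mu + INR j).
set (d := c - 1 - INR j).
replace (mu + INR (S j)) with (a + 1) by (unfold a; rewrite RtoC_INR_S; ring).
replace (c - INR (S j)) with d by (unfold d; rewrite RtoC_INR_S; ring).
replace (mu + 1 + INR j) with (a + 1) by (unfold a; ring).
replace (c - INR j) with (d + 1) by (unfold d; ring).
replace (alpha - S j)%nat with (alpha - 1 - j)%nat by lia.
replace (alpha - j)%nat with (S (alpha - 1 - j)) by lia.
change (1 + j)%nat with (S j).
(* This extracts [a] from [D j] and [d] from [D (S j)], leaving the same two Pochhammer factors, [u]
   and [v] below, in both. *)
rewrite !pochhammer_succ_l.
assert (ha : kummer_lower_ok a) by apply kummer_lower_ok_add, hmu.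
assert (hd : kummer_lower_ok d).
(* As [j <= alpha - 1], [d] exceeds [mu + beta] by a natural number. *)
{ replace d with (mu + beta + INR (alpha - 1 - j)).
  - apply kummer_lower_ok_add, hmb.
  - unfold d, c; rewrite !minus_INR, !RtoC_minus by lia; simpl; ring. }
pose proof (kummer_one_rec a x ha) as Ra.
pose proof (kummer_one_rec d x hd) as Rd.
set (u := pochhammer (a + 1) (alpha - 1 - j)).
set (v := pochhammer (d + 1) j).
transitivity (u * v * (kummer 1 (a + 1) x * (d * kummer 1 d x)
                       - (a * kummer 1 a x) * kummer 1 (d + 1) x)); [ring|].
(* Both products now contain [x * kummer 1 (a + 1) x * kummer 1 (d + 1) x], which cancels. *)
rewrite Ra, Rd; ring.
Qed.
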